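(* For every positive integer $m$, the orbit Cayley graph $Cay(Z_2^{4m+2},S_1\cup S_2)$ is strongly regular with parameters $$\left(2^{4m+2},\;2^{4m+1}+(-1)^m2^{2m},\;2^{4m}+(-1)^m2^{2m},\;2^{4m}+(-1)^m2^{2m}\right).$$
   Context: $Z_2^n$ is the elementary abelian $2$-group of rank $n$, viewed as the vector space $F_2^n$; here $n=4m+2$. For $v\in Z_2^n$, $|v|$ is the number of coordinates equal to $1$, and $O_i=\{v\in Z_2^n : |v|=i\}$ for $0\le i\le n$. Set $S_0=\bigcup_{i\neq 0,\ i\equiv 0 \,(\mathrm{mod}\ 4)}O_i$ and, for $a\in\{1,2,3\}$, $S_a=\bigcup_{i\equiv a\,(\mathrm{mod}\ 4)}O_i$, with $0\le i\le n$. For a group $G$ and $S\subseteq G$ with $1\notin S$ and $S=S^{-1}$, the Cayley graph $Cay(G,S)$ has vertex set $G$, with $x,y$ adjacent iff $x^{-1}y\in S$; it is called an orbit Cayley graph over $Z_2^n$ if $G=Z_2^n$ and $S$ is a union of some of the $O_i$. A strongly regular graph with parameters $(N,r,\lambda,\mu)$ is a connected $r$-regular graph on $N$ vertices in which any two adjacent vertices have exactly $\lambda$ common neighbours and any two distinct non-adjacent vertices have exactly $\mu$ common neighbours. *)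

(* Defs.v *)
From HB Require Import structures.
From mathcomp Require Import all_boot all_order all_algebra all_fingroup.
Set Implicit Arguments.
Unset Strict Implicit.
Unset Printing Implicit Defensive.
Import GRing.Theory.

(* The parameters are integers, not naturals, so that signed expressions such
   as 2 ^+ k + (-1) ^+ m * 2 ^+ l can be given as parameters without
   truncated subtraction. *)
Record strongly_regular (T : finType) (e : rel T) (N r lambda mu : int) : Prop :=
  StronglyRegular {
    srg_irrefl : irreflexive e;
    srg_sym : symmetric e;
    srg_connected : forall x y : T, connect e x y;
    srg_card : Posz #|T| = N;
    srg_regular : forall x : T, Posz #|[set y | e x y]| = r;
    srg_adjacent : forall x y : T, e x y ->
      Posz #|[set z | e x z && e y z]| = lambda;
    srg_nonadjacent : forall x y : T, x != y -> ~~ e x y ->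
      Posz #|[set z | e x z && e y z]| = mu }.

Definition cayley_rel (gT : finGroupType) (S : {set gT}) : rel gT :=
  fun x y => (x^-1 * y)%g \in S.

Definition cayley_set (gT : finGroupType) (S : {set gT}) : Prop :=
  (1%g \notin S) /\ (S = S^-1)%g.

(* The group law of this finGroupType is the addition of the vector space. *)
Definition Z2n (n : nat) : finGroupType := 'rV['F_2]_n.

Definition weight (n : nat) (v : 'rV['F_2]_n) : nat :=
  #|[set j : 'I_n | v ord0 j == 1%R]|.

Definition orbit_layer (n i : nat) : {set Z2n n} := [set v | weight v == i].

Definition orbit_cayley_set (n : nat) (S : {set Z2n n}) : Prop :=
  cayley_set S /\
  exists I : {set 'I_n.+1}, S = \bigcup_(i in I) orbit_layer n i.

(* The condition i != 0 only matters for a = 0 (mod 4). *)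
Definition layers_mod4 (n a : nat) : {set Z2n n} :=
  \bigcup_(i < n.+1 | ((i : nat) != 0%N) && (i == a %[mod 4])) orbit_layer n i.

(* Main.v *)
Require Import Defs.
From HB Require Import structures.
From mathcomp Require Import all_boot all_order all_algebra all_fingroup.
From mathcomp Require Import all_field zify ring.
Set Implicit Arguments.
Unset Strict Implicit.
Unset Printing Implicit Defensive.
Local Open Scope ring_scope.

Import GRing.Theory Num.Theory.

(** Put [f v = (-1)^C(|v|+1, 2)].  The exponent is odd exactly when [|v|] is 1
    or 2 modulo 4, so [f] is the sign function [1 - 2 * 1_S] of the connection
    set [S].  Over F_2 the exponent is the quadratic form
    [\sum_(i <= j) v_i v_j], and for even [n] its polar form is nondegenerate:
    [f] is a bent function.  Two consequences give all the parameters.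

    - [\sum_z f z * f (z + u) = 0] for [u != 0] (lemma [wsign_autocorrelation]).
      Indeed [f z * f (z + u) = f u * chi z], where [chi] is the character
      [z |-> (-1)^(|u| |z| + u.z)].  On the i-th unit vector it takes the
      value [(-1)^(|u| + u_i)]; it is trivial only if every [u_i] has the parity
      of [|u|], that is if [u = 0], or [u] is the all-one vector and [n] is odd.

    - [\sum_z f z = - (-1)^m 2^(2m+1)] for [n = 4m+2] (lemma [sum_wsign]).  As
      [f] depends on [|v|] modulo 4 only, [2 f v] is
      [(1 + i) i^|v| + (1 - i) (-i)^|v|], and the sum of [x^|v|] over all [v] is
      [(1 + x)^n]; so the sum of [f] is the real part of [(1 + i)^(4m+3)].

    Expanding the products of [1 - 2 * 1_A] turns the second sum into the degree
    [d] and the first into [2^n - 4 d + 4 C = 0], where [C] is the number of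
    common neighbours of two distinct vertices.  Hence [C] does not depend on
    adjacency, and since it is positive the graph is connected.

    Vectors are replaced by their supports, because sums over all subsets of
    products over their elements factor ([bigA_distr]). *)

(** * The sign function of the weight *)

Definition wsign (w : nat) : int := (-1) ^+ 'C(w.+1, 2).

(** This is the polarization [C(a+b+1, 2) = C(a+1, 2) + C(b+1, 2) + a b]. *)
Lemma wsignD a b : wsign (a + b) = wsign a * wsign b * (-1) ^+ (a * b).
Proof.
rewrite /wsign -!exprD; congr (_ ^+ _); elim: b => [|b IHb].
  by rewrite muln0 !addn0.
by rewrite addnS binS IHb bin1 (binS b.+1) bin1 mulnS; lia.
Qed.

Lemma wsign_double c : wsign c.*2 = (-1) ^+ c.
Proof.
elim: c => [|c IHc] //; rewrite doubleS -addn2 wsignD IHc muln2 exprS mulrC.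
by rewrite -(signr_odd _ (c.*2).*2) odd_double mul1r mulrC.
Qed.

Lemma wsignS2 w : wsign w.+2 = - wsign w.
Proof. by rewrite -addn2 wsignD muln2 -signr_odd odd_double mulr1 mulrN1. Qed.

Lemma wsignE w :
  wsign w = 1 - ((w %% 4 == 1)%N || (w %% 4 == 2)%N)%:R *+ 2.
Proof.
rewrite {1}(divn_eq w 4); have: (w %% 4 < 4)%N by rewrite ltn_mod.
have -> : (w %/ 4 * 4 = ((w %/ 4).*2).*2)%N by lia.
rewrite wsignD wsign_double -doubleMl -!(signr_odd _ _.*2) !odd_double.
rewrite mul1r mulr1.
by case: (w %% 4)%N => [|[|[|[|]]]].
Qed.

(** * Sums over all subsets *)

Lemma sum_setX (R : comNzRingType) (T : finType) (x : R) :
  \sum_(A : {set T}) x ^+ #|A| = (x + 1) ^+ #|T|.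
Proof.
have <- : \prod_(i : T) (x + 1) = (x + 1) ^+ #|T| by rewrite prodr_const.
rewrite bigA_distr; apply: eq_bigr => A _.
by rewrite -big_mkcond prodr_const.
Qed.

(** Both sides change sign when [w] grows by 2, so the cases [w = 0] and
    [w = 1] decide. *)
Lemma wsign_algC w :
  (wsign w)%:~R *+ 2 = (1 + 'i) * 'i ^+ w + (1 - 'i) * (- 'i) ^+ w :> algC.
Proof.
have i2 : 'i * 'i = -1 :> algC by rewrite -expr2 sqrCi.
elim/ltn_ind: w => [[|[|w]] IHw].
- by rewrite /wsign bin_small // !expr0; ring.
- by rewrite /wsign binn !expr1; ring: i2.
- by rewrite wsignS2 rmorphN mulNrn IHw // !exprS; ring: i2.
Qed.

(** The binomial theorem gives [(1 + i)^(4m+3) + (1 - i)^(4m+3)] for twice the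
    sum, and [(1 + z)^4 = -4] when [z^2 = -1]. *)
Lemma sum_wsign (T : finType) m : #|T| = (4 * m + 2)%N ->
  \sum_(A : {set T}) wsign #|A| = - ((-1) ^+ m * 2 ^+ (2 * m + 1)).
Proof.
move=> cT; apply: (@intr_inj algC).
apply: (@mulIf _ 2); first by rewrite pnatr_eq0.
rewrite rmorph_sum /= mulr_suml; under eq_bigr do rewrite mulr_natr wsign_algC.
rewrite big_split -!mulr_sumr !sum_setX cT /=.
have i2 : 'i * 'i = -1 :> algC by rewrite -expr2 sqrCi.
have pow4 (z : algC) :
    z * z = -1 -> (z + 1) ^+ (4 * m) = (-1) ^+ m * 2 ^+ (2 * m).
  move=> z2; rewrite !exprM -exprMn; congr (_ ^+ m); ring: z2.
rewrite !(exprD _ _ 2) (exprD _ _ 1) !pow4 ?mulrNN //.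
rewrite rmorphN !rmorphM !rmorphXn /= rmorphN1 !expr1 mulrA.
move: (_ * _ ^+ (2 * m)) => c; ring: i2.
Qed.

Lemma card_setDU (T : finType) (A U : {set T}) :
  (#|A :\: U :|: U :\: A| + #|A :&: U|.*2 = #|A| + #|U|)%N.
Proof.
have -> : #|A :\: U :|: U :\: A| = (#|A :\: U| + #|U :\: A|)%N.
  rewrite cardsU (_ : _ :&: _ = set0) ?cards0 ?subn0 //.
  by apply/setP=> x; rewrite !inE; case: (x \in A); case: (x \in U).
by rewrite -(cardsID U A) -(cardsID A U) (setIC U A); lia.
Qed.

(** Here [A :\: U :|: U :\: A] is the support of a sum of two vectors.  The
    function [g] below gives the values on singletons of the character [chi]; the
    sum of [chi] factors as [\prod_i (g i + 1)], and evenness of [#|T|] provides a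
    vanishing factor. *)
Lemma wsign_autocorrelation (T : finType) (U : {set T}) :
  ~~ odd #|T| -> U != set0 ->
  \sum_(A : {set T}) wsign #|A| * wsign #|A :\: U :|: U :\: A| = 0.
Proof.
move=> evT nzU.
pose g (i : T) : int := (-1) ^+ (#|U| + (i \in U))%N.
have prodg (A : {set T}) :
  wsign #|A| * wsign #|A :\: U :|: U :\: A| = wsign #|U| * \prod_(i in A) g i.
  have := congr1 wsign (card_setDU A U); rewrite wsignD wsign_double wsignD.
  have -> : \prod_(i in A) g i = (-1) ^+ (#|A| * #|U| + #|A :&: U|).
    rewrite prodrXr big_split sum_nat_const /=; congr (_ ^+ (_ + _)).
    rewrite -sum1_card [RHS]big_mkcond [LHS]big_mkcond.
    by apply: eq_bigr => i _; rewrite inE; case: (i \in A); case: (i \in U).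
  rewrite -muln2 mulnA muln2 -(signr_odd _ _.*2) odd_double mulr1 => eqD.
  have -> : wsign #|A :\: U :|: U :\: A| =
      wsign #|A| * wsign #|U| * (-1) ^+ (#|A| * #|U|) * (-1) ^+ #|A :&: U|.
    by rewrite -eqD -mulrA -expr2 sqrr_sign mulr1.
  by rewrite exprD !mulrA -expr2 sqrr_sign mul1r.
under eq_bigr do rewrite prodg big_mkcond.
rewrite -mulr_sumr -bigA_distr.
have [i gi] : exists i, g i = -1.
  case oU: (odd #|U|).
    have [i Ui] : exists i, i \notin U.
      (* Otherwise [U] is everything, of even size. *)
      apply/existsP; apply: contraLR oU; rewrite negb_exists => /forallP UT.
      rewrite (_ : U = setT) ?cardsT //.
      by apply/setP=> x; rewrite inE; move: (UT x); rewrite negbK.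
    by exists i; rewrite /g (negPf Ui) addn0 -signr_odd oU.
  have [i Ui] := set0Pn _ nzU.
  by exists i; rewrite /g Ui -signr_odd oddD oU.
by rewrite (bigD1 i) //= gi addNr mul0r mulr0.
Qed.

(** * From sign sums to cardinalities *)

Definition ind_sign (T : finType) (A : {set T}) (z : T) : int :=
  1 - (z \in A)%:R *+ 2.

Lemma sum_ind (T : finType) (A : {set T}) :
  \sum_z (z \in A)%:R = (#|A| : int).
Proof.
rewrite -natz -sum1_card natr_sum [RHS]big_mkcond.
by apply: eq_bigr => z _; case: ifP.
Qed.

Lemma sum_ind_sign (T : finType) (A : {set T}) :
  \sum_z ind_sign A z = (#|T| : int) - (#|A| : int) *+ 2.
Proof.
by rewrite sumrB sumr_const sumrMnl sum_ind natz.
Qed.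

Lemma sum_ind_signM (T : finType) (A B : {set T}) :
  \sum_z ind_sign A z * ind_sign B z =
  (#|T| : int) - (#|A| : int) *+ 2 - (#|B| : int) *+ 2
  + (#|A :&: B| : int) *+ 4.
Proof.
rewrite -!sum_ind -[Posz #|T|]natz -sumr_const -!sumrMnl -!sumrB -big_split.
apply: eq_bigr => z _; rewrite /ind_sign inE.
by case: (z \in A); case: (z \in B).
Qed.

(** * Binary vectors and their supports *)

Definition supp (n : nat) (v : 'rV['F_2]_n) : {set 'I_n} :=
  [set j | v ord0 j == 1].

Lemma F2_eqD (a b : 'F_2) : (a + b == 1) = (a == 1) (+) (b == 1).
Proof. by case: a b => [[|[|//]]] ? [[|[|//]]] ?. Qed.

Lemma suppD n (u v : 'rV['F_2]_n) :
  supp (u + v) = supp u :\: supp v :|: supp v :\: supp u.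
Proof.
by apply/setP=> j; rewrite !inE mxE F2_eqD; do 2!case: (_ == _).
Qed.

Lemma supp_bij n : bijective (@supp n).
Proof.
exists (fun A : {set 'I_n} => \row_j (j \in A)%:R) => [v|A].
  apply/rowP=> j; rewrite mxE inE; apply/eqP.
  by case: (v ord0 j) => [[|[|//]]] ?.
by apply/setP=> j; rewrite inE mxE; case: (j \in A).
Qed.

Lemma rVF2_oppE n (v : 'rV['F_2]_n) : - v = v.
Proof.
by apply/rowP=> j; rewrite mxE oppr_pchar2 // (@pchar_Fp 2).
Qed.

Lemma sum_supp n (R : nmodType) (F : {set 'I_n} -> R) :
  \sum_(v : 'rV['F_2]_n) F (supp v) = \sum_A F A.
Proof. by rewrite [RHS](reindex (@supp n)) //; apply/onW_bij/supp_bij. Qed.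

Lemma supp0 n : supp (0 : 'rV['F_2]_n) = set0.
Proof. by apply/setP=> j; rewrite !inE mxE. Qed.

Lemma mem_layers_mod4 n a (v : 'rV['F_2]_n) :
  v \in layers_mod4 n a = (weight v != 0%N) && (weight v == a %[mod 4]).
Proof.
apply/bigcupP/idP=> [[i Pi]|Pv]; first by rewrite inE => /eqP->.
have lt_v : (weight v < n.+1)%N by rewrite ltnS -[n in leqRHS]card_ord max_card.
by exists (Ordinal lt_v); rewrite // inE.
Qed.

(** * The Cayley graph *)

Theorem corollary5 (m : nat) (hm : (0 < m)%N) :
  let n := (4 * m + 2)%N in
  let S := layers_mod4 n 1 :|: layers_mod4 n 2 in
  orbit_cayley_set S /\
  strongly_regular (cayley_rel S)
    ((2 : int) ^+ (4 * m + 2)%N)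
    ((2 : int) ^+ (4 * m + 1)%N + (-1) ^+ m * 2 ^+ (2 * m)%N)
    ((2 : int) ^+ (4 * m)%N + (-1) ^+ m * 2 ^+ (2 * m)%N)
    ((2 : int) ^+ (4 * m)%N + (-1) ^+ m * 2 ^+ (2 * m)%N).
Proof.
move=> n S; set c := (-1) ^+ m * 2 ^+ (2 * m); set p := 2 ^+ (4 * m).
have pE : p = 2 ^+ (2 * m) * 2 ^+ (2 * m) by rewrite -exprD -mulnDl.
have VE (v : Z2n n) : (v^-1)%g = v by exact: rVF2_oppE.
have SE (v : Z2n n) :
    (v \in S) = (weight v %% 4 == 1)%N || (weight v %% 4 == 2)%N.
  by rewrite inE !mem_layers_mod4; case: eqP => [->|].
have SI : orbit_cayley_set S.
  split.
    split; first by rewrite SE /weight -/(supp 0) supp0 cards0.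
    by apply/setP=> v; rewrite mem_invg VE.
  exists [set i : 'I_n.+1 | (i %% 4 == 1)%N || (i %% 4 == 2)%N].
  apply/setP=> v; rewrite SE; apply/idP/bigcupP=> [Sv|[i]]; last first.
    by rewrite !inE => Si /eqP->.
  have lt_v : (weight v < n.+1)%N by rewrite ltnS -[n in leqRHS]card_ord max_card.
  by exists (Ordinal lt_v); rewrite inE.
split=> //.
pose N (x : Z2n n) := [set y | cayley_rel S x y].
have NE (x z : 'rV['F_2]_n) : ind_sign (N x) z = wsign #|supp (x + z)|.
  by rewrite /ind_sign inE /cayley_rel VE SE wsignE.
have cardT : (#|Z2n n| : int) = 4 * p.
  rewrite card_mx card_Fp // mul1n /n -natz natrX exprD mulrC -/p; lia.
have evn : ~~ odd #|'I_n| by rewrite card_ord /n; lia.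
have addxx (x z : 'rV['F_2]_n) : x + (x + z) = z.
  by rewrite -{1}[x]rVF2_oppE addKr.
(* In both sums below, translating the summation variable by [x] moves the
   base point to the origin. *)
have degN x : (#|N x| : int) = 2 * p + c.
  have := sum_ind_sign (N x); under eq_bigr do rewrite NE.
  rewrite (reindex_inj (addrI x)) /=; under eq_bigr do rewrite addxx.
  rewrite (sum_supp (fun A => wsign #|A|)) (sum_wsign (card_ord n)) cardT.
  rewrite addn1 exprS mulrCA -/c; lia.
have commonN x y : x != y -> (#|N x :&: N y| : int) = p + c.
  move=> neq_xy; have := sum_ind_signM (N x) (N y).
  rewrite (reindex_inj (addrI x)) /=.
  under eq_bigr => z _ do
    rewrite !NE addxx (addrC x z) (addrC y) -addrA suppD.
  pose U := supp (x + y).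
  rewrite (sum_supp (fun A => wsign #|A| * wsign #|A :\: U :|: U :\: A|)).
  rewrite wsign_autocorrelation // ?cardT ?degN; first lia.
  apply: contraNneq neq_xy; rewrite -(supp0 n) => /(bij_inj (supp_bij n)).
  by move/eqP; rewrite addr_eq0 rVF2_oppE.
have NI x y : [set z | cayley_rel S x z && cayley_rel S y z] = N x :&: N y.
  by apply/setP=> z; rewrite !inE.
have symS : symmetric (cayley_rel S).
  by move=> x y; rewrite /cayley_rel !VE; congr (_ \in S); exact: addrC.
have mu_neq0 : p + c != 0.
  have P_gt1 : 1 < 2 ^+ (2 * m) :> int by rewrite exprn_egt1 // muln_eq0 -lt0n.
  (* [p + c = 2^(2m) (2^(2m) + (-1)^m)], where [2^(2m) > 1] because [m > 0]. *)
  rewrite pE /c -mulrDl mulf_neq0 //; last by lia.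
  by rewrite -signr_odd; case: (odd m); rewrite ?expr1 ?expr0; lia.
have irrS x : cayley_rel S x x = false.
  by rewrite /cayley_rel mulVg; case: SI => [[/negPf]].
split=> //.
- move=> x y; have [->|neq_xy] := eqVneq x y; first exact: connect0.
  have /set0Pn[z] : N x :&: N y != set0.
    by apply: contra_neq mu_neq0 => N0; rewrite -(commonN x y) // N0 cards0.
  rewrite !inE => /andP[xz yz]; apply: connect_trans (connect1 xz) _.
  by rewrite connect1 // symS.
- by rewrite cardT exprD; lia.
- by move=> x; rewrite degN addn1 exprS.
- move=> x y xy; rewrite NI commonN //.
  by apply: contraTneq xy => ->; rewrite irrS.
- by move=> x y neq_xy _; rewrite NI commonN.
Qed.
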